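(* Let $\mathcal{H}$ be a complex Hilbert space and let $A\in\mathcal{B}(\mathcal{H})$ be a positive operator with $0\leq A\leq I$. If $A$ is the asymptotic limit of a contraction $T\in\mathcal{B}(\mathcal{H})$, i.e. $A=A_T$, then one of the following three possibilities occurs: (i) $A=0$; (ii) $A$ is a non-zero finite rank (orthogonal) projection, $\mathcal{H}=\mathcal{H}_0(T)\oplus\mathcal{H}_1(T)$ (orthogonal sum) and $\dim\mathcal{H}_1(T)\in\mathbb{N}$; (iii) $\|A\|=r_e(A)=1$.
   Context: $\mathcal{B}(\mathcal{H})$ is the C*-algebra of bounded linear operators on $\mathcal{H}$, $I$ is the identity. $T\in\mathcal{B}(\mathcal{H})$ is a contraction if $\|T\|\leq 1$. For a contraction $T$, the decreasing sequence of positive operators $T^{*n}T^n$ converges in the strong operator topology; its limit $A_T:=\lim_{n\to\infty}T^{*n}T^n$ is called the asymptotic limit of $T$. ''Positive'' means positive semidefinite. $\mathcal{H}_0(T):=\{x\in\mathcal{H}:\lim_{n\to\infty}\|T^nx\|=0\}$ is the stable subspace of $T$, and $\mathcal{H}_1(T):=\{x\in\mathcal{H}:\lim_{n\to\infty}\|T^nx\|=\|x\|\}$; both are closed subspaces, with $\mathcal{H}_0(T)=\ker A_T$ and $\mathcal{H}_1(T)=\ker(A_T-I)$. $r_e(A)$ is the essential spectral radius of $A$, i.e. the largest modulus of an element of the essential spectrum $\sigma_e(A)$ (the spectrum of the image of $A$ in the quotient of $\mathcal{B}(\mathcal{H})$ by the compact operators). $\mathbb{N}=\{1,2,3,\dots\}$.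 *)

(* Defs.v *)
From HB Require Import structures.
From mathcomp Require Import all_boot all_order all_algebra.
From mathcomp Require Import complex.
From mathcomp Require Import all_classical all_reals all_analysis.

Set Implicit Arguments.
Unset Strict Implicit.
Unset Printing Implicit Defensive.

Import Order.TTheory GRing.Theory Num.Theory.
Import numFieldNormedType.Exports.

Local Open Scope classical_set_scope.
Local Open Scope complex_scope.
Local Open Scope ring_scope.

(* The inner product is linear in its first argument and conjugate-linear in
   its second one. *)
HB.mixin Record CompleteNormedModule_isHilbert (R : realType) H
    of CompleteNormedModule R[i] H := {
  inner : {dot H for @Num.conj R[i]};
  inner_norm : forall x : H, `|x| ^+ 2 = inner x x
}.

#[short(type="hilbertType")]
HB.structure Definition Hilbert (R : realType) :=
  {H of CompleteNormedModule R[i] H & CompleteNormedModule_isHilbert R H}.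

(* Norms over [R[i]] take values in the nonnegative reals of [R[i]]. *)
Definition rnorm (R : realType) (V : normedZmodType R[i]) (x : V) : R :=
  complex.Re `|x|.

Section Operators.
Context {R : realType} {H : hilbertType R}.
Implicit Types (T S A B : H -> H) (x y : H) (z : R[i]).

Definition bounded_op T := linear T /\ bounded_near T (nbhs (0 : H)).

Definition opnorm T : R := sup [set rnorm (T x) | x in [set x | rnorm x <= 1]].

Definition contraction_op T := bounded_op T /\ opnorm T <= 1.

Definition positive_op T := forall x, 0 <= inner (T x) x.

Definition op_le A B := positive_op (B \- A).

(* For bounded [T] there is exactly one such map, by Riesz representation. *)
Definition adjoint T : H -> H :=
  get [set S | forall x y, inner (T x) y = inner x (S y)].

(* Strong convergence of T*^n T^n to A. *)
Definition is_asymptotic_limit T A :=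
  forall x, iter n (adjoint T) (iter n T x) @[n --> \oo] --> A x.

Definition stable_subspace T : set H :=
  [set x | rnorm (iter n T x) @[n --> \oo] --> (0 : R)].

Definition isometric_subspace T : set H :=
  [set x | rnorm (iter n T x) @[n --> \oo] --> rnorm x].

Definition lin_indep n (e : 'I_n -> H) := forall c : 'I_n -> R[i],
  \sum_(i < n) c i *: e i = 0 -> forall i, c i = 0.

Definition has_dim (V : set H) n := exists2 e : 'I_n -> H, lin_indep e &
  V = [set \sum_(i < n) c i *: e i | c in [set: 'I_n -> R[i]]].

Definition finite_rank A := exists n, has_dim (range A) n.

Definition orthogonal_projection A := A \o A = A /\ adjoint A = A.

Definition orthogonal_sum (V W : set H) :=
  (forall v w, V v -> W w -> inner v w = 0) /\
  [set v + w | v in V & w in W] = setT.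

Definition compact_op T :=
  bounded_op T /\ precompact (T @` [set x | rnorm x <= 1]).

(* Equality, and invertibility, of the images in the quotient of the bounded
   operators by the compact ones. *)
Definition calkin_eq S T := compact_op (S \- T).

Definition calkin_unit S := exists T,
  [/\ bounded_op T, calkin_eq (S \o T) id & calkin_eq (T \o S) id].

Definition essential_spectrum A : set R[i] :=
  [set z | ~ calkin_unit (fun x => A x - z *: x)].

(* The largest modulus; it is set to 0 when the essential spectrum is empty,
   i.e., when [H] is finite-dimensional. *)
Definition essential_spectral_radius A : R :=
  let moduli := [set rnorm z | z in essential_spectrum A] in
  xget 0 [set r | moduli r /\ ubound moduli r].

End Operators.

(* Main.v *)
(* <A T^n x, T^n x> = <A x, x> for all n, because both are the limit of |T^m x|^2.
   If <A y, y> <= q |y|^2 with q < 1 on a T-invariant set V, then letting n go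
   to infinity in <A x, x> <= q |T^n x|^2 gives <A x, x> <= q <A x, x>, so A
   vanishes on V.  With V = H, this shows |A| = 1 unless A = 0.

   The essential spectrum of A lies in the unit disc, so r_e(A) = 1 as soon as 1
   belongs to it.  Otherwise A - 1 is invertible modulo the compact operators,
   hence N = ker (A - 1) is finite-dimensional and A - 1 is bounded below on the
   orthogonal of N.  T is isometric on N and maps N into N, hence onto N by
   finiteness of the dimension; as T*T = 1 on N, T* also maps N into N, so T
   preserves the orthogonal of N.  The bound below provides a q < 1 there, so A
   vanishes on it: A is the orthogonal projection onto N. *)
Require Import Defs.
From HB Require Import structures.
From mathcomp Require Import all_boot all_order all_algebra.
From mathcomp Require Import complex sesquilinear.
From mathcomp Require Import all_classical all_reals all_analysis.
From mathcomp Require Import ring lra.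
Import Order.TTheory GRing.Theory Num.Theory.
Import numFieldNormedType.Exports.
Local Open Scope classical_set_scope.
Local Open Scope ring_scope.

(** * Norms and inner products *)

Section RealNorm.
Context {R : realType} {V : normedZmodType R[i]}.
Implicit Types x y : V.

Lemma normr_rnorm x : `|x| = (rnorm x)%:C%C.
Proof. by rewrite /rnorm RRe_real// normr_real. Qed.

Lemma rnorm_ge0 x : 0 <= rnorm x.
Proof. by rewrite -ler0c -normr_rnorm. Qed.

Lemma rnorm0 : rnorm (0 : V) = 0.
Proof. by rewrite /rnorm normr0. Qed.

Lemma rnorm_eq0 x : rnorm x = 0 -> x = 0.
Proof. by move=> x0; apply/eqP; rewrite -normr_eq0 normr_rnorm x0. Qed.

Lemma rnormN x : rnorm (- x) = rnorm x.
Proof. by rewrite /rnorm normrN. Qed.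

Lemma rnormB x y : rnorm (x - y) = rnorm (y - x).
Proof. by rewrite /rnorm distrC. Qed.

Lemma ler_rnormD x y : rnorm (x + y) <= rnorm x + rnorm y.
Proof. by rewrite -lecR rmorphD/= -!normr_rnorm ler_normD. Qed.

End RealNorm.

Section ComplexNumbers.
Context {R : realType}.

Lemma rnorm_real (a : R) : rnorm (a%:C%C : R[i]) = `|a|.
Proof. by rewrite /rnorm normc_def/= expr0n addr0 sqrtr_sqr. Qed.

Lemma Re_conj (z : R[i]) : complex.Re z^* = complex.Re z.
Proof. by case: z. Qed.

End ComplexNumbers.

Section Hilbert.
Context {R : realType} {H : hilbertType R}.
Implicit Types (x y z : H).

Lemma rnormZ (a : R[i]) x : rnorm (a *: x) = rnorm a * rnorm x.
Proof. by apply: complexI; rewrite rmorphM/= -!normr_rnorm normrZ. Qed.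

(** The real part is a real inner product, so inequalities and limits can be handled in [R] instead
    of [R[i]]. *)
Definition ip x y : R := complex.Re (inner x y).

Lemma innerC x y : inner x y = (inner y x)^*.
Proof. by rewrite hermC/= expr0 mul1r. Qed.

Lemma innerDl x y z : inner (x + y) z = inner x z + inner y z.
Proof. exact: linearDl. Qed.

Lemma innerBl x y z : inner (x - y) z = inner x z - inner y z.
Proof. exact: linearBl. Qed.

Lemma inner0l x : inner 0 x = 0.
Proof. exact: linear0l. Qed.

Lemma innerDr x y z : inner z (x + y) = inner z x + inner z y.
Proof. exact: linearDr. Qed.

Lemma innerZl (a : R[i]) x y : inner (a *: x) y = a * inner x y.
Proof. by rewrite linearZl_LR. Qed.

Lemma innerZr (a : R[i]) x y : inner x (a *: y) = a^* * inner x y.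
Proof. by rewrite linearZr_LR. Qed.

Lemma ipC x y : ip x y = ip y x.
Proof. by rewrite /ip innerC Re_conj. Qed.

Lemma ipDl x y z : ip (x + y) z = ip x z + ip y z.
Proof. by rewrite /ip innerDl raddfD. Qed.

Lemma ipNl x z : ip (- x) z = - ip x z.
Proof. by rewrite /ip linearNl raddfN. Qed.

Lemma ipBl x y z : ip (x - y) z = ip x z - ip y z.
Proof. by rewrite ipDl ipNl. Qed.

Lemma ipDr x y z : ip z (x + y) = ip z x + ip z y.
Proof. by rewrite !(ipC z) ipDl. Qed.

Lemma ipNr x z : ip z (- x) = - ip z x.
Proof. by rewrite !(ipC z) ipNl. Qed.

Lemma ipBr x y z : ip z (x - y) = ip z x - ip z y.
Proof. by rewrite !(ipC z) ipBl. Qed.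

Lemma ipZl (a : R) x y : ip (a%:C%C *: x) y = a * ip x y.
Proof. by rewrite /ip innerZl; case: (inner x y) => b c /=; rewrite mul0r subr0. Qed.

Lemma ipZr (a : R) x y : ip x (a%:C%C *: y) = a * ip x y.
Proof. by rewrite !(ipC x) ipZl. Qed.

Lemma ip0r x : ip x 0 = 0.
Proof. by rewrite -[0]subr0 ipBr subrr. Qed.

Lemma ip_rnorm x : ip x x = rnorm x ^+ 2.
Proof. by rewrite /ip -inner_norm normr_rnorm -rmorphXn. Qed.

Lemma ip_iZl x y : ip ('i%C *: x) y = - complex.Im (inner x y).
Proof. by rewrite /ip innerZl mulrC ReiNIm. Qed.

(** The real part of [<i x, y>] is minus the imaginary part of [<x, y>]. *)
Lemma inner_eq_ip x y x' y' : ip x y = ip x' y' ->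
  ip ('i%C *: x) y = ip ('i%C *: x') y' -> inner x y = inner x' y'.
Proof.
rewrite !ip_iZl /ip => re /oppr_inj im.
by apply/eqP; rewrite eq_complex re im !eqxx.
Qed.

Lemma ip_nondeg x y : (forall z, ip z x = ip z y) -> x = y.
Proof.
move=> xy; apply/eqP; rewrite -subr_eq0; apply/eqP/rnorm_eq0/eqP.
by rewrite -sqrf_eq0 -ip_rnorm ipBr xy subrr.
Qed.

Lemma rnormD_sqr x y :
  rnorm (x + y) ^+ 2 = rnorm x ^+ 2 + 2 * ip x y + rnorm y ^+ 2.
Proof. rewrite -!ip_rnorm ipDl !ipDr (ipC y x); ring. Qed.

Lemma rnormB_sqr x y :
  rnorm (x - y) ^+ 2 = rnorm x ^+ 2 - 2 * ip x y + rnorm y ^+ 2.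
Proof. by rewrite rnormD_sqr rnormN ipNr mulrN. Qed.

(** The triangle inequality is part of the normed structure; squaring it gives Cauchy-Schwarz. *)
Lemma cauchy_schwarz x y : ip x y <= rnorm x * rnorm y.
Proof.
have := ler_rnormD x y; rewrite -ler_sqr ?nnegrE ?addr_ge0 ?rnorm_ge0//.
rewrite rnormD_sqr; lra.
Qed.

Lemma cauchy_schwarz_norm x y : `|ip x y| <= rnorm x * rnorm y.
Proof.
by rewrite ler_norml lerNl -ipNl -{1}(rnormN x) !cauchy_schwarz.
Qed.

Lemma cvg_rnorm_lt (u : nat -> H) x (e : R) : u @ \oo --> x -> 0 < e ->
  \forall n \near \oo, rnorm (x - u n) < e.
Proof.
move=> /cvgrPdist_lt ux e0; have /ux : 0 < e%:C%C by rewrite ltcR.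
by apply: filterS => n; rewrite normr_rnorm ltcR.
Qed.

Lemma cvg_ip (u : nat -> H) x y : u @ \oo --> x ->
  ip (u n) y @[n --> \oo] --> ip x y.
Proof.
move=> ux; apply/cvgrPdist_lt => e e0.
have y0 : 0 < rnorm y + 1 by rewrite ltr_wpDl// rnorm_ge0.
have : 0 < e / (rnorm y + 1) by rewrite divr_gt0.
move=> /(cvg_rnorm_lt _ _ _ ux); apply: filterS => n; rewrite ltr_pdivlMr// => xu.
rewrite -ipBl (le_lt_trans (cauchy_schwarz_norm _ _))// (le_lt_trans _ xu)//.
by rewrite ler_wpM2l ?rnorm_ge0// lerDl.
Qed.

(* Unlike [linearD] and the like, these never match the linear map [*:%R a]. *)
Lemma opD (T : {linear H -> H}) x y : T (x + y) = T x + T y.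
Proof. exact: linearD. Qed.

Lemma opB (T : {linear H -> H}) x y : T (x - y) = T x - T y.
Proof. exact: linearB. Qed.

Lemma opZ (T : {linear H -> H}) (a : R[i]) x : T (a *: x) = a *: T x.
Proof. exact: linearZ. Qed.

Lemma op0 (T : {linear H -> H}) : T 0 = 0.
Proof. exact: linear0. Qed.

(** Bundles a bare linear function, so that the theory of linear maps applies to it after
    rewriting. *)
Lemma linear_op (T : H -> H) : linear T -> {L : {linear H -> H} | T = L}.
Proof.
move=> lT.
by exists (HB.pack_for {linear H -> H} T (GRing.isLinear.Build _ _ _ _ T lT)).
Qed.

Lemma bounded_opP (T : {linear H -> H}) :
  bounded_op T <-> exists2 M, 0 <= M & forall x, rnorm (T x) <= M * rnorm x.
Proof.
split=> [[_ /linear_boundedP/pinfty_ex_gt0[M M0 TM]]|[M M0 TM]].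
  have ME : M = (complex.Re M)%:C%C by rewrite RRe_real// gtr0_real.
  exists (complex.Re M) => [|x]; first by rewrite -ler0c -ME ltW.
  by rewrite -lecR rmorphM/= -!normr_rnorm -ME.
split; first exact: linearP.
apply/linear_boundedP; exists M%:C%C; split; first by rewrite complex_real.
move=> r Mr x; apply: le_trans (_ : M%:C%C * `|x| <= _).
  by rewrite !normr_rnorm -rmorphM/= lecR.
by rewrite ler_wpM2r// ltW.
Qed.

End Hilbert.

(** * Riesz representation and adjoints *)

Section Riesz.
Context {R : realType} {H : hilbertType R}.
Implicit Types (x y z : H).

Lemma rnorm_cauchy_cvg (u : nat -> H) :
  (forall e : R, 0 < e -> exists N, forall n, (N <= n)%N -> rnorm (u N - u n) < e) ->
  exists x, u @ \oo --> x.
Proof.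
move=> uC; suff : cvg (u @ \oo) by move=> ?; exists (lim (u @ \oo)).
apply/cauchy_cvgP/cauchy_exP => e e0.
have eE : e = (complex.Re e)%:C%C by rewrite RRe_real// gtr0_real.
have /uC[N uN] : 0 < complex.Re e by rewrite -ltcR -eE.
exists (u N); exists N => // n /= Nn.
by rewrite -ball_normE/= normr_rnorm eE ltcR; exact: uN.
Qed.

Lemma cvg_op (T : {linear H -> H}) (u : nat -> H) x : bounded_op T ->
  u @ \oo --> x -> T (u n) @[n --> \oo] --> T x.
Proof.
move=> [_ /linear_bounded_continuous Tc] ux.
by apply: cvg_comp ux _; exact: Tc.
Qed.

(* The Riesz representation theorem for the form [<C x, C y>]: [C = id] gives
   adjoints, and [C = A - conj z] the invertibility of [A - z = C*].  The vector
   minimises [J z = |C z|^2 - 2 g z]; minimising sequences are Cauchy by the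
   parallelogram identity. *)
Section Minimisation.
Variables (C : {linear H -> H}) (c : R) (g : H -> R) (K : R).
Hypotheses (C_bounded : bounded_op C) (c_gt0 : 0 < c).
Hypothesis C_coercive : forall x, c * rnorm x <= rnorm (C x).
Hypothesis gD : forall x y, g (x + y) = g x + g y.
Hypothesis gZ : forall (a : R) x, g (a%:C%C *: x) = a * g x.
Hypothesis g_bounded : forall x, g x <= K * rnorm x.

Let J z := rnorm (C z) ^+ 2 - 2 * g z.
Let m := inf (range J).

Let has_inf_J : has_inf (range J).
Proof.
split; first by exists (J 0); exists 0.
(* With [t = c |x|], completing the square gives [t^2 - 2 (K / c) t >= - (K / c)^2]. *)
exists (- (K / c) ^+ 2) => _ [x _ <-]; rewrite /J.
have gx : g x <= (K / c) * (c * rnorm x).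
  by rewrite mulrA divfK ?gt_eqF//; exact: g_bounded.
have cx : (c * rnorm x) ^+ 2 <= rnorm (C x) ^+ 2.
  by rewrite ler_sqr ?nnegrE ?rnorm_ge0// mulr_ge0 ?rnorm_ge0// ltW.
have := sqr_ge0 (K / c - c * rnorm x).
nra.
Qed.

Let m_le z : m <= J z.
Proof. by apply: ge_inf; [exact: has_inf_J.2|exists z]. Qed.

Let parallelogram x y :
  J x + J y - 2 * J ((2^-1)%:C%C *: (x + y)) = rnorm (C (x - y)) ^+ 2 / 2.
Proof.
rewrite /J gZ gD opZ opB opD rnormZ rnorm_real ger0_norm ?invr_ge0//.
by rewrite exprMn rnormD_sqr rnormB_sqr; field.
Qed.

Let close x y : (c * rnorm (x - y)) ^+ 2 <= 2 * (J x + J y - 2 * m).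
Proof.
apply: le_trans (_ : rnorm (C (x - y)) ^+ 2 <= _).
  by rewrite ler_sqr ?nnegrE ?rnorm_ge0// mulr_ge0 ?rnorm_ge0// ltW.
have := parallelogram x y; have := m_le ((2^-1)%:C%C *: (x + y)); lra.
Qed.

(** An approximate Euler equation: a near-minimiser almost represents [g], with an error that
    vanishes along a minimising sequence. *)
Let variation z x : (ip (C z) (C x) - g x) ^+ 2 <= (J z - m) * rnorm (C x) ^+ 2.
Proof.
set d := ip _ _ - _; have [Cx0|Cx0] := eqVneq (rnorm (C x) ^+ 2) 0.
  have x0 : x = 0.
    apply/rnorm_eq0/eqP; rewrite eq_le rnorm_ge0 andbT -(pmulr_rle0 _ c_gt0).
    by move/eqP : Cx0 (C_coercive x); rewrite sqrf_eq0 => /eqP ->.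
  have g0 : g 0 = 0 by rewrite -(scaler0 _ (0 : R)%:C%C) gZ mul0r.
  by rewrite Cx0 mulr0 /d x0 op0 ip0r g0 subrr expr0n.
have Cx_gt0 : 0 < rnorm (C x) ^+ 2 by rewrite lt_def Cx0 sqr_ge0.
(* [J (z + t x) = J z + 2 t d + t^2 |C x|^2] is smallest at [t = - d / |C x|^2]. *)
have := m_le (z + (- d / rnorm (C x) ^+ 2)%:C%C *: x).
rewrite {1}/J gD gZ opD opZ rnormD_sqr ipZr rnormZ rnorm_real exprMn.
rewrite real_normK ?num_real// => mle.
rewrite -ler_pdivrMr// -subr_ge0.
suff -> : J z - m - d ^+ 2 / rnorm (C x) ^+ 2 = rnorm (C z) ^+ 2 +
    2 * (- d / rnorm (C x) ^+ 2 * ip (C z) (C x)) +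
    (- d / rnorm (C x) ^+ 2) ^+ 2 * rnorm (C x) ^+ 2 -
    2 * (g z + - d / rnorm (C x) ^+ 2 * g x) - m by rewrite subr_ge0.
rewrite /J.
have -> : ip (C z) (C x) = d + g x by rewrite subrK.
by field; rewrite -sqrf_eq0.
Qed.

Lemma coercive_riesz : exists z, forall x, ip (C z) (C x) = g x.
Proof.
have /choice[z Jz] n : exists z, J z < m + n.+1%:R^-1.
  have n0 : 0 < n.+1%:R^-1 :> R by rewrite invr_gt0.
  by have [_ [z _ <-]] := inf_adherent n0 has_inf_J; exists z.
have [w zw] : exists w : H, z @ \oo --> w.
  apply: rnorm_cauchy_cvg => e e0.
  (* [close] bounds [(c |z_N - z_n|)^2] by twice the sum of the two excesses over [m]; each excess
     is below this quarter. *)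
  have ce : 0 < (c * e) ^+ 2 / 4 by rewrite divr_gt0// exprn_gt0// mulr_gt0.
  have [N _ Ne] : \forall n \near \oo, n.+1%:R^-1 < (c * e) ^+ 2 / 4 :> R.
    exact: near_infty_natSinv_lt (PosNum ce).
  exists N => n Nn; rewrite -(ltr_pM2l c_gt0).
  rewrite -ltr_sqr ?nnegrE ?mulr_ge0 ?rnorm_ge0 1?ltW//.
  apply: le_lt_trans (close _ _) _.
  have := Ne _ (leqnn N); have := Ne _ Nn; have := Jz N; have := Jz n.
  move: (n.+1%:R^-1) (N.+1%:R^-1) => a b /=; lra.
exists w => x; apply/eqP; rewrite -subr_eq0 -sqrf_eq0 eq_le sqr_ge0 andbT.
have d_cvg : (ip (C (z n)) (C x) - g x) ^+ 2 @[n --> \oo] -->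
    (ip (C w) (C x) - g x) ^+ 2.
  by apply: cvgM; (apply: cvgB; [exact/cvg_ip/cvg_op|exact: cvg_cst]).
have b_cvg : n.+1%:R^-1 * rnorm (C x) ^+ 2 @[n --> \oo] --> (0 : R).
  by rewrite -[X in _ --> X](mul0r (rnorm (C x) ^+ 2));
    apply: cvgMr_tmp; exact: cvg_harmonic.
apply: ler_cvg_to d_cvg b_cvg _; near=> n.
rewrite (le_trans (variation _ _))// ler_wpM2r ?sqr_ge0//.
by rewrite lerBlDl; exact: ltW.
Unshelve. all: by end_near. Qed.

End Minimisation.

Lemma riesz (g : H -> R) (K : R) : (forall x y, g (x + y) = g x + g y) ->
  (forall (a : R) x, g (a%:C%C *: x) = a * g x) ->
  (forall x, g x <= K * rnorm x) -> exists z, forall x, ip x z = g x.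
Proof.
move=> gD gZ gK.
have idb : bounded_op (idfun : {linear H -> H}).
  by apply/bounded_opP; exists 1 => // x; rewrite mul1r.
have [x|z zg] := @coercive_riesz idfun 1 g K idb ltr01 _ gD gZ gK.
  by rewrite mul1r.
by exists z => x; rewrite ipC zg.
Qed.

(** [adjoint] is chosen by [get], so its specification rests on the existence of a candidate. Riesz
    supplies one for real parts; evaluating at [i x] extends the identity to [inner]. *)
Lemma adjointE (T : {linear H -> H}) : bounded_op T ->
  forall x y, inner (T x) y = inner x (adjoint T y).
Proof.
move=> /bounded_opP[M M0 TM].
suff : exists S, forall x y, inner (T x) y = inner x (S y).
  move=> [S TS].
  exact: (@getPex _ [set S | forall x y, inner (T x) y = inner x (S y)]
    (ex_intro _ S TS)).
have /choice[S TS] y : exists z, forall x, ip x z = ip (T x) y.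
  apply: (@riesz _ (M * rnorm y)) => [x x'|a x|x].
  - by rewrite opD ipDl.
  - by rewrite opZ ipZl.
  - rewrite (le_trans (cauchy_schwarz _ _))// mulrAC ler_wpM2r ?rnorm_ge0//.
exists S => x y; apply: inner_eq_ip; first by rewrite TS.
by rewrite TS opZ.
Qed.

End Riesz.

(** * Operator norm *)

Section OperatorNorm.
Context {R : realType} {H : hilbertType R}.
Implicit Types (x y z : H) (T : {linear H -> H}).

Lemma opnorm_ge T x : bounded_op T -> rnorm (T x) <= opnorm T * rnorm x.
Proof.
move=> /bounded_opP[M M0 TM].
have [x0|x0] := eqVneq (rnorm x) 0.
  by rewrite (rnorm_eq0 _ x0) op0 rnorm0 mulr0.
have x_gt0 : 0 < rnorm x by rewrite lt_def x0 rnorm_ge0.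
have ux : rnorm ((rnorm x)^-1%:C%C *: x) = 1.
  by rewrite rnormZ rnorm_real ger0_norm ?mulVf// invr_ge0 rnorm_ge0.
rewrite -ler_pdivrMr//; apply: ub_le_sup.
  exists M => _ [y /= y1 <-]; rewrite (le_trans (TM y))//.
  by rewrite -[leRHS]mulr1 ler_wpM2l.
exists ((rnorm x)^-1%:C%C *: x); first by rewrite /= ux.
by rewrite opZ rnormZ rnorm_real ger0_norm ?invr_ge0 ?rnorm_ge0// mulrC.
Qed.

Lemma opnorm_le T (q : R) : 0 <= q -> (forall x, rnorm (T x) <= q * rnorm x) ->
  opnorm T <= q.
Proof.
move=> q0 Tq; apply: ge_sup; first by exists (rnorm (T 0)), 0 => //=; rewrite rnorm0.
move=> _ [y /= y1 <-]; rewrite (le_trans (Tq y))//.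
by rewrite -[leRHS]mulr1 ler_wpM2l.
Qed.

End OperatorNorm.

(** * Positive operators below the identity *)

Section Effects.
Context {R : realType} {H : hilbertType R}.
Implicit Types (x y z : H) (A B T : {linear H -> H}).

Lemma positive_opP (A : H -> H) x : positive_op A -> 0 <= ip (A x) x.
Proof. by move=> /(_ x); rewrite lecE => /andP[_]. Qed.

(** Polarisation: positivity makes [<A w, w>] real for every [w], in particular for
    [w = u + i v]. *)
Lemma positive_op_sym A x y : positive_op A -> inner (A x) y = inner x (A y).
Proof.
move=> A0.
have Asym u v : ip (A u) v = ip u (A v).
  have Im0 w : complex.Im (inner (A w) w) = 0.
    by have := A0 w; rewrite lecE => /andP[/eqP].
  have := Im0 (u + 'i%C *: v).
  rewrite opD opZ innerDl !innerDr !innerZl !innerZr !raddfD/= Im0 (ipC u) /ip.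
  case: (inner (A u) v) (inner (A v) u) (Im0 v) => a b [c d].
  by case: (inner (A v) v) => r s /= ->; lra.
by apply: inner_eq_ip; rewrite -?opZ Asym.
Qed.

(** This is [B^2 <= B]: add [<B y, y> >= 0] at [y = x - B x] to [<B y, y> <= |y|^2] at [y = B x]. *)
Lemma effect_norm_sqr B x : (forall y, 0 <= ip (B y) y) ->
  (forall y z, ip (B y) z = ip y (B z)) ->
  (forall y, ip (B y) y <= rnorm y ^+ 2) -> rnorm (B x) ^+ 2 <= ip (B x) x.
Proof.
move=> B0 Bsym B1; have := B0 (x - B x); have := B1 (B x).
rewrite opB !ipBl !ipBr (Bsym (B x) x) ip_rnorm; lra.
Qed.

End Effects.

(** * Asymptotic limits of contractions *)

Section AsymptoticLimit.
Context {R : realType} {H : hilbertType R}.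
Implicit Types (x y z : H).
Variables (A T : {linear H -> H}).
Hypotheses (A_ge0 : forall x, 0 <= ip (A x) x)
  (A_sym : forall x y, inner (A x) y = inner x (A y))
  (A_le1 : forall x, ip (A x) x <= rnorm x ^+ 2).
Hypotheses (T_bounded : bounded_op T)
  (T_contraction : forall x, rnorm (T x) <= rnorm x)
  (A_lim : is_asymptotic_limit T A).

Lemma effect_ipC x y : ip (A x) y = ip x (A y).
Proof. by rewrite /ip A_sym. Qed.

Lemma effect_ker x : ip (A x) x = 0 -> A x = 0.
Proof.
move=> Ax0; apply/rnorm_eq0/eqP; rewrite -sqrf_eq0 eq_le sqr_ge0 andbT -Ax0.
exact/effect_norm_sqr/A_le1/effect_ipC/A_ge0.
Qed.

Lemma effect_contraction x : rnorm (A x) <= rnorm x.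
Proof.
rewrite -ler_sqr ?nnegrE ?rnorm_ge0// (le_trans _ (A_le1 x))//.
exact/effect_norm_sqr/A_le1/effect_ipC/A_ge0.
Qed.

(** [1 - A] also lies between [0] and [1], so [effect_norm_sqr] applies to it. *)
Lemma effect_compl_norm_sqr x : rnorm (x - A x) ^+ 2 <= rnorm x ^+ 2 - ip (A x) x.
Proof.
have /linear_op[B BE] : linear (fun y => y - A y).
  by move=> a u v; rewrite opD opZ opprD addrACA scalerBr.
have BA y : B y = y - A y by rewrite -BE.
have := @effect_norm_sqr _ _ B x; rewrite BA ipBl ip_rnorm; apply => y.
- by rewrite BA ipBl ip_rnorm subr_ge0.
- by move=> z; rewrite !BA ipBl ipBr effect_ipC.
- by rewrite BA ipBl ip_rnorm gerBl.
Qed.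

Lemma effect_fix x : ip (A x) x = rnorm x ^+ 2 -> A x = x.
Proof.
move=> Axx; apply/esym/eqP; rewrite -subr_eq0; apply/eqP/rnorm_eq0/eqP.
rewrite -sqrf_eq0 eq_le sqr_ge0 andbT (le_trans (effect_compl_norm_sqr x))//.
by rewrite Axx subrr.
Qed.

Lemma cvg_asymptotic_limit x : rnorm (iter n T x) ^+ 2 @[n --> \oo] --> ip (A x) x.
Proof.
suff -> : (fun n => rnorm (iter n T x) ^+ 2) =
    (fun n => ip (iter n (adjoint T) (iter n T x)) x).
  exact/cvg_ip/A_lim.
apply/funext => n; rewrite -ip_rnorm.
(* Each of the [n] adjoints moves across the inner product as a [T], which leaves [|T^n x|^2]. *)
suff sw y z : ip y (iter n T z) = ip (iter n (adjoint T) y) z by rewrite sw.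
elim: n y z => //= n ih y z.
by rewrite ipC {1}/ip adjointE// -/(ip _ _) ipC ih -iterSr.
Qed.

Lemma asymptotic_limit_shift x : ip (A (T x)) (T x) = ip (A x) x.
Proof.
apply: (@cvg_unique _ _ ((fun n => rnorm (iter n T (T x)) ^+ 2) @ \oo)) => //.
  exact: cvg_asymptotic_limit.
have -> : (fun n => rnorm (iter n T (T x)) ^+ 2) =
    (fun n => rnorm (iter n.+1 T x) ^+ 2) by apply/funext => n; rewrite -iterSr.
by have := cvg_asymptotic_limit x;
  rewrite -(cvg_shiftS (fun n => rnorm (iter n T x) ^+ 2)).
Qed.

Lemma asymptotic_limit_iter n x :
  ip (A (iter n T x)) (iter n T x) = ip (A x) x.
Proof. by elim: n => //= n ih; rewrite asymptotic_limit_shift. Qed.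

(** Used twice: on the whole space with [q] the norm of [A], and on the orthogonal of the fixed
    vectors of [A]. *)
Lemma asymptotic_limit_gap (V : set H) (q : R) : q < 1 ->
  (forall x, V x -> V (T x)) ->
  (forall x, V x -> ip (A x) x <= q * rnorm x ^+ 2) ->
  forall x, V x -> A x = 0.
Proof.
move=> q1 VT Vq x Vx; apply: effect_ker; apply/eqP.
rewrite eq_le A_ge0 andbT -(@pmulr_rle0 _ (1 - q)) ?subr_gt0//.
rewrite mulrBl mul1r subr_le0.
have qcvg : q * rnorm (iter n T x) ^+ 2 @[n --> \oo] --> q * ip (A x) x.
  by apply: cvgMl_tmp; exact: cvg_asymptotic_limit.
apply: ler_cvg_to (cvg_cst _) qcvg _; apply: nearW => n.
rewrite -(asymptotic_limit_iter n x); apply: Vq.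
by elim: n => //= n; exact: VT.
Qed.

(** With [r = 0] and [r = |x|] this turns the two subspaces of [T] into conditions on the quadratic
    form of [A]. *)
Lemma cvg_rnorm_iter x (r : R) : 0 <= r ->
  rnorm (iter n T x) @[n --> \oo] --> r <-> ip (A x) x = r ^+ 2.
Proof.
move=> r0; split=> [Tr|Axr].
  apply: (@cvg_unique _ _ ((fun n => rnorm (iter n T x) ^+ 2) @ \oo)) => //.
    exact: cvg_asymptotic_limit.
  exact: cvgM.
have := cvg_asymptotic_limit x; rewrite Axr => Tr.
rewrite -(ger0_norm r0) -sqrtr_sqr.
suff -> : (fun n => rnorm (iter n T x)) =
    (fun n => Num.sqrt (rnorm (iter n T x) ^+ 2)).
  by apply: continuous_cvg Tr; exact: sqrt_continuous.
by apply/funext => n; rewrite sqrtr_sqr ger0_norm ?rnorm_ge0.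
Qed.

Lemma stable_subspaceE : stable_subspace T = [set x | A x = 0].
Proof.
apply/seteqP; split=> x /= Tx.
  by apply/effect_ker; have /cvg_rnorm_iter := Tx; rewrite expr0n; exact.
by apply/cvg_rnorm_iter => //; rewrite Tx ipC ip0r expr0n.
Qed.

Lemma isometric_subspaceE : isometric_subspace T = [set x | A x = x].
Proof.
apply/seteqP; split=> x /= Tx.
  by apply/effect_fix/cvg_rnorm_iter => //; exact: rnorm_ge0.
by apply/cvg_rnorm_iter; [exact: rnorm_ge0|rewrite Tx ip_rnorm].
Qed.

(** Here [|x|^2 = <A T x, T x> <= |T x|^2 <= |x|^2], so equality holds throughout and [T x] is
    fixed. Then [y = T* T x] satisfies [<y, x> = |x|^2] and [|y| <= |x|], which forces [y = x]. *)
Lemma asymptotic_limit_fix_shift x : A x = x ->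
  A (T x) = T x /\ adjoint T (T x) = x.
Proof.
move=> Ax; have nTx : rnorm (T x) = rnorm x.
  apply/eqP; rewrite eq_le T_contraction/= -ler_sqr ?nnegrE ?rnorm_ge0//.
  by rewrite -ip_rnorm -{1}Ax -asymptotic_limit_shift.
split; first by apply: effect_fix; rewrite asymptotic_limit_shift Ax ip_rnorm nTx.
set y := adjoint T (T x).
have yx z : ip z y = ip (T z) (T x) by rewrite /ip -adjointE.
have ny : rnorm y <= rnorm x.
  have := yx y; rewrite ip_rnorm => yy.
  have : rnorm y ^+ 2 <= rnorm y * rnorm x.
    by rewrite yy (le_trans (cauchy_schwarz _ _))// ler_pM ?rnorm_ge0.
  by have := rnorm_ge0 y; have := rnorm_ge0 x; nra.
apply/eqP; rewrite -subr_eq0; apply/eqP/rnorm_eq0/eqP.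
rewrite -sqrf_eq0 eq_le sqr_ge0 andbT rnormB_sqr ipC yx ip_rnorm nTx.
have : rnorm y ^+ 2 <= rnorm x ^+ 2 by rewrite ler_sqr ?nnegrE ?rnorm_ge0.
lra.
Qed.

End AsymptoticLimit.

(** * Orthonormal families and compactness *)

Section Orthonormal.
Context {R : realType} {H : hilbertType R}.
Implicit Types (x y z : H) (V : set H).

Definition orthonormal_family n (e : 'I_n -> H) :=
  forall i j, inner (e i) (e j) = (i == j)%:R.

Definition oproj n (e : 'I_n -> H) x := \sum_(i < n) inner x (e i) *: e i.

Definition linear_subspace V :=
  V 0 /\ forall (a : R[i]) x y, V x -> V y -> V (a *: x + y).

Lemma inner_suml n (c : 'I_n -> R[i]) (e : 'I_n -> H) y :
  inner (\sum_(i < n) c i *: e i) y = \sum_(i < n) c i * inner (e i) y.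
Proof.
rewrite (big_morph (fun x => inner x y) (id1 := 0) (op1 := +%R)).
- by apply: eq_bigr => i _; rewrite innerZl.
- by move=> u v; rewrite innerDl.
- exact: inner0l.
Qed.

Lemma inner_orthonormal_sum n (e : 'I_n -> H) (c : 'I_n -> R[i]) j :
  orthonormal_family n e -> inner (\sum_(i < n) c i *: e i) (e j) = c j.
Proof.
move=> eo; rewrite inner_suml (bigD1 j)//= eo eqxx mulr1 big1 ?addr0// => i ij.
by rewrite eo (negbTE ij) mulr0.
Qed.

Lemma inner_oproj n (e : 'I_n -> H) x j : orthonormal_family n e ->
  inner (oproj n e x) (e j) = inner x (e j).
Proof. exact: inner_orthonormal_sum. Qed.

Lemma oproj_orthonormal_sum n (e : 'I_n -> H) (c : 'I_n -> R[i]) :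
  orthonormal_family n e ->
  oproj n e (\sum_(i < n) c i *: e i) = \sum_(i < n) c i *: e i.
Proof.
by move=> eo; apply: eq_bigr => i _; rewrite inner_orthonormal_sum.
Qed.

Lemma orthonormal_lin_indep n (e : 'I_n -> H) :
  orthonormal_family n e -> lin_indep e.
Proof.
move=> eo c c0 i; have := inner_orthonormal_sum n e c i eo.
by rewrite c0 inner0l.
Qed.

Lemma subspace_sum V n (e : 'I_n -> H) (c : 'I_n -> R[i]) : linear_subspace V ->
  (forall i, V (e i)) -> V (\sum_(i < n) c i *: e i).
Proof.
move=> [V0 VD] Ve; apply: big_rec => // i x _; exact: VD.
Qed.

Lemma subspaceB V x y : linear_subspace V -> V x -> V y -> V (x - y).
Proof.
by move=> [_ VD] Vx Vy; rewrite addrC -scaleN1r; exact: VD.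
Qed.

Lemma subspaceZ V (a : R[i]) x : linear_subspace V -> V x -> V (a *: x).
Proof. by move=> [V0 VD] Vx; rewrite -[_ *: _]addr0; exact: VD. Qed.

(** One Gram-Schmidt step: the normalised residual of [x] becomes the last vector. *)
Lemma orthonormal_extend V n (e : 'I_n -> H) x : linear_subspace V ->
  orthonormal_family n e -> (forall i, V (e i)) -> V x -> x <> oproj n e x ->
  exists2 e' : 'I_n.+1 -> H, orthonormal_family n.+1 e' & forall i, V (e' i).
Proof.
move=> Vs eo Ve Vx xP; pose y := x - oproj n e x.
have ye i : inner y (e i) = 0.
  by rewrite /y innerBl inner_oproj// subrr.
have ny : rnorm y != 0.
  by apply/eqP => /rnorm_eq0/eqP; rewrite subr_eq0 => /eqP.
pose w := (rnorm y)^-1%:C%C *: y.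
have ww : inner w w = 1.
  rewrite -inner_norm normr_rnorm rnormZ rnorm_real ger0_norm.
    by rewrite mulVf// expr1n.
  by rewrite invr_ge0 rnorm_ge0.
have we i : inner w (e i) = 0 by rewrite innerZl ye mulr0.
exists (fun i => if unlift ord_max i is Some j then e j else w) => [i j|i].
  case: unliftP => [i'|] ->; case: unliftP => [j'|] ->.
  - by rewrite eo (inj_eq lift_inj).
  - by rewrite innerC we conjC0 eq_sym (negbTE (neq_lift _ _)).
  - by rewrite we (negbTE (neq_lift _ _)).
  - by rewrite ww eqxx.
case: unliftP => [i'|] _ //; apply: subspaceZ => //.
by apply: subspaceB => //; exact: subspace_sum.
Qed.

(** Every orthonormal family of the maximal length spans [V], not just a chosen one; this is later
    applied to both [e] and [T \o e]. *)
Lemma orthonormal_maximal V k : linear_subspace V ->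
  (forall n (e : 'I_n -> H), orthonormal_family n e -> (forall i, V (e i)) ->
    (n <= k)%N) ->
  exists n, (exists2 e : 'I_n -> H, orthonormal_family n e & forall i, V (e i)) /\
    forall e : 'I_n -> H, orthonormal_family n e -> (forall i, V (e i)) ->
      forall x, V x -> x = oproj n e x.
Proof.
move=> Vs Vk; pose P n := `[< exists2 e : 'I_n -> H,
  orthonormal_family n e & forall i, V (e i)>].
have P0 : exists n, P n.
  by exists 0%N; apply/asboolP; exists (fun=> 0) => -[].
have Pk n : P n -> (n <= k)%N by move=> /asboolP[e eo Ve]; exact: Vk eo Ve.
case: (ex_maxnP P0 Pk) => n /asboolP en nmax; exists n; split=> // e eo Ve x Vx.
apply: contrapT => xP.
have /asboolP/nmax : exists2 e' : 'I_n.+1 -> H,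
    orthonormal_family n.+1 e' & forall i, V (e' i).
  exact: orthonormal_extend Vs eo Ve Vx xP.
by rewrite ltnn.
Qed.

(** Cover [U] by finitely many balls of radius [r / 2]: each contains at most one [u i], so [k] is
    the number of balls. *)
Lemma compact_separated (U : set H) (r : R) : compact U -> 0 < r ->
  exists k, forall n (u : 'I_n -> H), (forall i, U (u i)) ->
    (forall i j, i != j -> r <= rnorm (u i - u j)) -> (n <= k)%N.
Proof.
rewrite compact_cover => Uc r0.
have r2 : 0 < (r / 2)%:C%C :> R[i] by rewrite ltcR divr_gt0.
have [||D _ UD] := Uc H setT (fun y => (ball y (r / 2)%:C%C)°).
- by move=> y _; exact: open_interior.
- by move=> y Uy; exists y => //; exact: nbhsx_ballx.
exists (size (finmap.enum_fset D)) => n u Uu sep.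
have /choice[f fD] i : exists y, y \in finmap.enum_fset D /\ rnorm (y - u i) < r / 2.
  have [y Dy /interior_subset] := UD _ (Uu i).
  by rewrite -ball_normE/= normr_rnorm ltcR => yu; exists y.
have f_inj : injective f.
  move=> i j fij; apply/eqP; apply: contraT => /sep.
  rewrite leNgt => /negP[]; have [_ i2] := fD i; have [_ j2] := fD j.
  have := ler_rnormD (u i - f i) (f i - u j).
  by rewrite addrA subrK (rnormB (u i) (f i)) {2}fij; lra.
rewrite -[n in (n <= _)%N]card_ord cardT -(size_map f).
apply: uniq_leq_size; first by rewrite map_inj_uniq// enum_uniq.
by move=> _ /mapP[i _ ->]; have [] := fD i.
Qed.

(** Meant for [K = S B - 1] and [V = ker B]. The vectors [- e i] lie in a compact set, at mutual
    distance [sqrt 2 >= 1]. *)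
Lemma orthonormal_fixed_bounded (K : H -> H) V :
  precompact (K @` [set x | rnorm x <= 1]) -> (forall x, V x -> K x = - x) ->
  exists k, forall n (e : 'I_n -> H), orthonormal_family n e ->
    (forall i, V (e i)) -> (n <= k)%N.
Proof.
move=> [U KU [Uc _]] VK; have [k Uk] := compact_separated U 1 Uc ltr01.
exists k => n e eo Ve; have e1 i : rnorm (e i) ^+ 2 = 1.
  by rewrite -ip_rnorm /ip eo eqxx.
apply: (Uk n (fun i => - e i)) => [i|i j ij].
  rewrite -VK//; apply: KU; exists (e i) => //=.
  by have := e1 i; have := rnorm_ge0 (e i); nra.
rewrite -opprD rnormN -ler_sqr ?nnegrE ?rnorm_ge0// expr1n.
rewrite rnormB_sqr !e1 /ip eo (negbTE ij)/=; lra.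
Qed.

(* A sequence of unit vectors of the orthogonal of [ker B] which [B] sends to
   [0] has, up to sign, a cluster point; that point lies in [ker B], at distance
   at least [1] from the sequence. *)
Lemma fredholm_bounded_below (B S : {linear H -> H}) :
  bounded_op B -> bounded_op S ->
  precompact ((fun x => S (B x) - x) @` [set x | rnorm x <= 1]) ->
  exists2 c : R, 0 < c & forall x, (forall y, B y = 0 -> ip x y = 0) ->
    c * rnorm x <= rnorm (B x).
Proof.
move=> /bounded_opP[MB MB0 BM] /bounded_opP[MS MS0 SM] [U KU [Uc _]].
apply: contrapT => nc.
(* Each [c = 1 / (n + 1)] fails; normalising a counterexample gives [x n]. *)
have /choice[x xP] n : exists x, [/\ forall y, B y = 0 -> ip x y = 0,
    rnorm x = 1 & rnorm (B x) < n.+1%:R^-1].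
  apply: contrapT => nx; apply: nc; exists n.+1%:R^-1 => [|x xN].
    by rewrite invr_gt0.
  rewrite leNgt; apply/negP => Bx; apply: nx.
  have x0 : rnorm x != 0.
    by apply: contraTneq Bx => ->; rewrite mulr0 -leNgt rnorm_ge0.
  have x_gt0 : 0 < rnorm x by rewrite lt_def x0 rnorm_ge0.
  have xV : rnorm ((rnorm x)^-1%:C%C : R[i]) = (rnorm x)^-1.
    by rewrite rnorm_real ger0_norm// invr_ge0 rnorm_ge0.
  exists ((rnorm x)^-1%:C%C *: x); split.
  - by move=> y /xN xy; rewrite ipZl xy mulr0.
  - by rewrite rnormZ xV mulVf.
  - by rewrite opZ rnormZ xV mulrC ltr_pdivrMr.
pose K y := S (B y) - y.
have [p [_ pcl]] : U `&` cluster (K (x n) @[n --> \oo]) !=set0.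
  apply: Uc; exists 0%N => // n _; apply: KU; exists (x n) => //=.
  by have [_ -> _] := xP n.
have p_close (e : R) : 0 < e -> exists n,
    rnorm (B (x n)) < e /\ rnorm (p - K (x n)) < e.
  move=> e0; have [N _ Ne] : \forall n \near \oo, n.+1%:R^-1 < e.
    exact: near_infty_natSinv_lt (PosNum e0).
  have e0C : 0 < (e%:C%C : R[i]) by rewrite ltcR.
  have KN : (K (x n) @[n --> \oo]) [set K (x n) | n in [set n | (N <= n)%N]].
    by exists N => // n Nn; exists n.
  have [_ [[n Nn <-]]] := pcl _ _ KN (nbhsx_ballx p _ e0C).
  rewrite -ball_normE/= normr_rnorm ltcR => pK; exists n; split=> //.
  by have [_ _ Bx] := xP n; rewrite (lt_trans Bx)//; exact: Ne.
have Bp : B p = 0.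
  apply/rnorm_eq0/eqP; rewrite eq_le rnorm_ge0 andbT; apply/ler_addgt0Pr => e e0.
  (* The constant comes from [B p = B (p - K x_n) + B S B x_n - B x_n], where [B x_n] and
     [p - K x_n] are smaller than [d]. *)
  rewrite add0r; have M0 : 0 < MB + MB * MS + 1.
    by rewrite ltr_wpDl// addr_ge0// mulr_ge0.
  have [n [Bx pK]] := p_close _ (divr_gt0 e0 M0).
  move: Bx pK; set d := e / _ => Bx pK.
  have -> : e = MB * d + MB * MS * d + d
    by rewrite -[X in _ + X]mul1r -!mulrDl mulrC /d divfK// gt_eqF.
  have -> : B p = B (p - K (x n)) + B (S (B (x n))) - B (x n).
    by rewrite -addrA -opB -opD subrK.
  rewrite (le_trans (ler_rnormD _ _))// rnormN lerD ?(ltW Bx)//.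
  rewrite (le_trans (ler_rnormD _ _))// lerD//.
    by rewrite (le_trans (BM _))// ler_wpM2l// ltW.
  rewrite (le_trans (BM _))// -mulrA ler_wpM2l// (le_trans (SM _))//.
  by rewrite ler_wpM2l// ltW.
have M0 : 0 < MS + 1 by rewrite ltr_wpDl.
have [n [Bx pK]] := p_close _ (divr_gt0 ltr01 M0).
move: Bx pK; set d := 1 / _ => Bx pK.
have d1 : MS * d + d = 1.
  by rewrite -[X in _ + X]mul1r -mulrDl mulrC /d divfK ?gt_eqF.
have [xN x1 _] := xP n.
have : rnorm (x n + p) < 1.
  (* Both summands are small, so [|x_n + p| < 1], whereas orthogonality of [x_n] to [p] gives
     [|x_n + p|^2 = 1 + |p|^2]. *)
  have -> : x n + p = S (B (x n)) + (p - K (x n)).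
    by rewrite /K opprB addrCA subrKC addrC.
  rewrite (le_lt_trans (ler_rnormD _ _))// -d1 ler_ltD// (le_trans (SM _))//.
  by rewrite ler_wpM2l// ltW.
rewrite -ltr_sqr ?nnegrE ?rnorm_ge0// rnormD_sqr xN// x1 mulr0 addr0 expr1n.
by rewrite gtrDl ltNge sqr_ge0.
Qed.

End Orthonormal.

(** * Essential spectrum *)

Section Spectrum.
Context {R : realType} {H : hilbertType R}.
Implicit Types (x y z : H).

Lemma linear_shift (A : {linear H -> H}) (z : R[i]) : linear (fun x => A x - z *: x).
Proof.
by move=> a x y; rewrite opD opZ scalerDr opprD addrACA scalerBr !scalerA (mulrC z).
Qed.

Lemma bounded_shift (A : {linear H -> H}) (z : R[i]) :
  bounded_op A -> bounded_op (fun x => A x - z *: x).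
Proof.
move=> /bounded_opP[M M0 AM]; have [B BE] := linear_op _ (linear_shift A z).
rewrite BE; apply/bounded_opP; exists (M + rnorm z) => [|x].
  by rewrite addr_ge0 ?rnorm_ge0.
rewrite -BE (le_trans (ler_rnormD _ _))// rnormN mulrDl rnormZ lerD//.
Qed.

Lemma shift_coercive (A : {linear H -> H}) (z : R[i]) x :
  (forall x, rnorm (A x) <= rnorm x) ->
  (rnorm z - 1) * rnorm x <= rnorm (A x - z *: x).
Proof.
move=> A1; have := ler_rnormD (A x) (z *: x - A x).
rewrite addrC subrK rnormZ rnormB; have := A1 x; lra.
Qed.

(** [C] plays the adjoint of [B]. The lower bound on [B] gives injectivity and a bounded inverse;
    the one on [C] gives surjectivity, since [<C w, C x> = <y, x>] for all [x] means
    [B (C w) = y]. *)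
Lemma coercive_invertible (B C : {linear H -> H}) (c : R) : 0 < c ->
  bounded_op C -> (forall x, c * rnorm x <= rnorm (C x)) ->
  (forall x, c * rnorm x <= rnorm (B x)) ->
  (forall x y, ip (C x) y = ip x (B y)) ->
  exists S, [/\ bounded_op S, cancel S B & cancel B S].
Proof.
move=> c0 Cb Cc Bc CB.
have Binj x y : B x = B y -> x = y.
  move=> Bxy; apply/eqP; rewrite -subr_eq0; apply/eqP/rnorm_eq0/eqP.
  rewrite eq_le rnorm_ge0 andbT -(pmulr_rle0 _ c0) (le_trans (Bc _))//.
  by rewrite opB Bxy subrr rnorm0.
have /choice[S BS] y : exists v, B v = y.
  have [|a x|x|w Cw] := coercive_riesz C c (ip y) (rnorm y) Cb c0 Cc.
  - by move=> u v; rewrite ipDr.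
  - by rewrite ipZr.
  - exact: cauchy_schwarz.
  by exists (C w); apply: ip_nondeg => x; rewrite -CB ipC Cw ipC.
have /linear_op[L LE] : linear S.
  by move=> a x y; apply: Binj; rewrite opD opZ !BS.
exists S; split=> // [|x]; last exact/Binj/BS.
rewrite LE; apply/bounded_opP; exists c^-1 => [|x]; first by rewrite invr_ge0 ltW.
by rewrite -LE mulrC ler_pdivlMr// mulrC -{2}(BS x).
Qed.

Lemma compact_op0 (K : H -> H) : (forall x, K x = 0) -> compact_op K.
Proof.
move=> K0; have -> : K = (fun=> 0) by apply/funext.
have /linear_op[L LE] : linear (fun _ : H => 0 : H).
  by move=> a x y; rewrite scaler0 addr0.
split.
  rewrite LE; apply/bounded_opP; exists 0 => // x.
  by rewrite -LE mul0r rnorm0.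
exists [set 0]; first by move=> _ [x _ <-].
split; first exact: compact_set1.
exact/accessible_closed_set1/hausdorff_accessible/norm_hausdorff.
Qed.

(** If [|z| > 1], then [A - z] and its adjoint [A - conj z] are bounded below by [|z| - 1], so
    [A - z] has a genuine inverse and both compact remainders are [0]. *)
Lemma essential_spectrum_le1 (A : {linear H -> H}) (z : R[i]) : bounded_op A ->
  (forall x y, inner (A x) y = inner x (A y)) ->
  (forall x, rnorm (A x) <= rnorm x) ->
  essential_spectrum A z -> rnorm z <= 1.
Proof.
move=> Ab Asym A1; apply: contra_notP => /negP; rewrite -ltNge => z1.
have [B BE] := linear_op _ (linear_shift A z).
have [C CE] := linear_op _ (linear_shift A z^*).
have zc : rnorm z^* = rnorm z by rewrite /rnorm norm_conjC.
have z0 : 0 < rnorm z - 1 by rewrite subr_gt0.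
have [||||S [Sb SB BS]] := coercive_invertible B C _ z0.
- by rewrite -CE; exact: bounded_shift.
- by move=> x; rewrite -CE -zc; exact: shift_coercive.
- by move=> x; rewrite -BE; exact: shift_coercive.
- by move=> x y; rewrite -BE -CE ipBl ipBr /ip Asym innerZl innerZr.
exists S; split=> //; rewrite /calkin_eq BE; apply: compact_op0 => x /=.
- by rewrite SB subrr.
- by rewrite BS subrr.
Qed.

Lemma calkin_unit_left (A : H -> H) : calkin_unit A -> exists S,
  bounded_op S /\ precompact ((fun x => S (A x) - x) @` [set x | rnorm x <= 1]).
Proof. by move=> [S [Sb _ [_ K]]]; exists S. Qed.

Lemma essential_spectral_radius1 (A : H -> H) : essential_spectrum A 1 ->
  (forall z : R[i], essential_spectrum A z -> rnorm z <= 1) ->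
  essential_spectral_radius A = 1.
Proof.
move=> A1 Ale; rewrite /essential_spectral_radius.
have n1 : rnorm (1 : R[i]) = 1 by rewrite /rnorm normr1.
(* Since [P] contains [1], [xget] returns an element of [P] and not its default [0]; a largest
   modulus is unique. *)
set P := [set r | _]; have P1 : P 1.
  split; first by exists 1.
  by move=> _ [z Az <-]; exact: Ale.
have [[z Az zE] ub] : P (xget 0 P) by exact: xgetPex (ex_intro _ 1 P1).
apply/eqP; rewrite eq_le -{1}zE Ale//=; apply: ub.
by exists 1.
Qed.

End Spectrum.

(** * Norm one, and finite-rank projections when [1] is outside the essential spectrum *)

Section Dichotomy.
Context {R : realType} {H : hilbertType R}.
Implicit Types (x y z : H).
Variables (A T : {linear H -> H}).
Hypotheses (A_bounded : bounded_op A) (A_ge0 : forall x, 0 <= ip (A x) x)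
  (A_sym : forall x y, inner (A x) y = inner x (A y))
  (A_le1 : forall x, ip (A x) x <= rnorm x ^+ 2).
Hypotheses (T_bounded : bounded_op T)
  (T_contraction : forall x, rnorm (T x) <= rnorm x)
  (A_lim : is_asymptotic_limit T A).

Lemma asymptotic_limit_opnorm : (exists x, A x <> 0) -> opnorm A = 1.
Proof.
move=> [x Ax]; apply/eqP; rewrite eq_le opnorm_le//=; last first.
  by move=> y; rewrite mul1r; exact: effect_contraction.
rewrite leNgt; apply/negP => A1; apply: Ax.
have gap := asymptotic_limit_gap A T A_ge0 A_sym A_le1 T_bounded A_lim.
apply: (gap setT _ A1) => // y _.
rewrite (le_trans (cauchy_schwarz _ _))// expr2 mulrA ler_wpM2r ?rnorm_ge0//.
exact: opnorm_ge.
Qed.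

Lemma asymptotic_limit_finite_projection : ~ essential_spectrum A 1 ->
  exists n (e : 'I_n -> H), orthonormal_family n e /\ A = oproj n e :> (H -> H).
Proof.
move=> /contrapT/calkin_unit_left[S [Sb KS]].
have [B BE] := linear_op _ (linear_shift A 1).
have BA x : B x = A x - x by rewrite -BE scale1r.
have Bb : bounded_op B by rewrite -BE; exact: bounded_shift.
have [L LE] := linear_op _ Sb.1; rewrite {S}LE in Sb KS.
have {}KS : precompact ((fun x => L (B x) - x) @` [set x | rnorm x <= 1]).
  by rewrite -BE.
pose N := [set x | A x = x].
have B0 x : B x = 0 <-> N x.
  by rewrite BA; split=> [/eqP|->]; rewrite ?subrr// subr_eq0 => /eqP.
have Ns : linear_subspace N.
  by split=> [|a x y Nx Ny]; rewrite /N/= ?op0// opD opZ Nx Ny.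
have [k Nk] : exists k, forall n (e : 'I_n -> H), orthonormal_family n e ->
    (forall i, N (e i)) -> (n <= k)%N.
  by apply: orthonormal_fixed_bounded KS _ => x /B0 ->; rewrite op0 sub0r.
have [n [[e eo Ne] nmax]] := orthonormal_maximal N k Ns Nk.
have TN x : N x -> N (T x) /\ adjoint T (T x) = x.
  exact: asymptotic_limit_fix_shift.
have Te : orthonormal_family n (T \o e).
  by move=> i j /=; rewrite adjointE// (TN _ (Ne j)).2 eo.
(* [T \o e] also has maximal length in [N], so [y = T v] with [v] in [N], and
   [T* y = T* T v = v]. *)
have TsN y : N y -> N (adjoint T y).
  move=> /(nmax _ Te (fun i => (TN _ (Ne i)).1)) ->; rewrite /oproj.
  set c := fun i => inner y (T (e i)).
  have -> : \sum_(i < n) inner y ((T \o e) i) *: (T \o e) i =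
      T (\sum_(i < n) c i *: e i).
    by rewrite linear_sum; apply: eq_bigr => i _; rewrite /= opZ.
  have Nc : N (\sum_(i < n) c i *: e i) by exact: subspace_sum.
  by rewrite (TN _ Nc).2.
pose V := [set x | forall y, N y -> ip x y = 0].
have VT x : V x -> V (T x).
  by move=> Vx y Ny; rewrite /ip adjointE// -/(ip _ _); exact/Vx/TsN.
have [c c0 cB] := fredholm_bounded_below B L Bb Sb KS.
have AV x : V x -> A x = 0.
  have gap := asymptotic_limit_gap A T A_ge0 A_sym A_le1 T_bounded A_lim.
  (* On [V], [c^2 |y|^2 <= |y - A y|^2 <= |y|^2 - <A y, y>]. *)
  apply: (gap V (1 - c ^+ 2)) => //.
    by rewrite gtrBl exprn_gt0.
  move=> y Vy; have : c * rnorm y <= rnorm (B y).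
    by apply: cB => z /B0; exact: Vy.
  rewrite BA rnormB -ler_sqr ?nnegrE ?rnorm_ge0//; last first.
    by rewrite mulr_ge0 ?rnorm_ge0// ltW.
  have := effect_compl_norm_sqr A A_ge0 A_sym A_le1 y.
  rewrite exprMn; lra.
exists n, e; split=> //; apply/funext => x.
have Nx : N (oproj n e x) by exact: subspace_sum.
(* [A] fixes the projection of [x] and kills the residual, which is orthogonal to every [e i] and
   hence to [N]. *)
rewrite -[in LHS](subrK (oproj n e x) x) opD Nx AV ?add0r// => y Ny.
rewrite (nmax _ eo Ne _ Ny) ipC /ip inner_suml big1// => i _.
by rewrite [inner (e i) _]innerC innerBl inner_oproj// subrr conjC0 mulr0.
Qed.

End Dichotomy.

Theorem theorem1 (R : realType) (H : hilbertType R) (A T : H -> H)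
    (A_bounded : bounded_op A)
    (A_ge0 : op_le (fun=> 0) A)
    (A_le1 : op_le A id)
    (T_contraction : contraction_op T)
    (A_lim : is_asymptotic_limit T A) :
  [\/ A = (fun=> 0),
      [/\ A <> (fun=> 0),
          orthogonal_projection A,
          finite_rank A,
          orthogonal_sum (stable_subspace T) (isometric_subspace T)
        & exists2 n : nat, (0 < n)%N & has_dim (isometric_subspace T) n]
    | opnorm A = 1 /\ essential_spectral_radius A = 1].
Proof.
(* Both operators are replaced by bundled linear maps, and the order hypotheses by inequalities on
   [ip]. *)
have [A' AE] := linear_op _ A_bounded.1; move: A' AE => A' AE; subst A.
move: A' A_bounded A_ge0 A_le1 A_lim => A A_bounded A_ge0 A_le1 A_lim.
case: T_contraction => T_bounded; have [T' TE] := linear_op _ T_bounded.1.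
subst T; move: T' T_bounded A_lim => T T_bounded A_lim T1.
have {}A_ge0 : positive_op A by move=> x; have := A_ge0 x; rewrite /= subr0.
have A0 x : 0 <= ip (A x) x by exact: positive_opP.
have Asym x y : inner (A x) y = inner x (A y) by exact: positive_op_sym.
have {}A_le1 x : ip (A x) x <= rnorm x ^+ 2.
  by have := positive_opP _ x A_le1; rewrite /= ipBl ip_rnorm subr_ge0.
have {}T1 x : rnorm (T x) <= rnorm x.
  by rewrite (le_trans (opnorm_ge T x T_bounded))// ler_piMl ?rnorm_ge0.
have [[x Ax]|Az] := pselect (exists x, A x <> 0); last first.
  apply: Or31; apply/funext => x; apply: contrapT => Ax.
  by apply: Az; exists x.
have [A1|A1] := pselect (essential_spectrum A 1).
  apply: Or33; split.
    by apply: (asymptotic_limit_opnorm A T) => //; exists x.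
  apply: essential_spectral_radius1 => // z; apply: essential_spectrum_le1 => //.
  exact: effect_contraction.
have [n [e [eo AP]]] := asymptotic_limit_finite_projection A T A_bounded A0
  Asym A_le1 T_bounded T1 A_lim A1.
have AA y : A (A y) = A y by rewrite AP; exact: oproj_orthonormal_sum.
(* The fixed vectors are the span of [e]; they form both the range of [A] and the isometric subspace
   of [T]. *)
have fixA : [set y | A y = y] =
    [set \sum_(i < n) c i *: e i | c in [set: 'I_n -> R[i]]].
  apply/seteqP; split=> [y /= <-|_ [c _ <-]].
    by rewrite AP; exists (fun i => inner y (e i)).
  by rewrite /= AP oproj_orthonormal_sum.
have dim_fix : has_dim [set y | A y = y] n.
  by exists e => //; exact: orthonormal_lin_indep.
have isoE := isometric_subspaceE A T A0 Asym A_le1 T_bounded A_lim.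
have staE := stable_subspaceE A T A0 Asym A_le1 T_bounded A_lim.
apply: Or32; split.
- by move=> A00; apply: Ax; rewrite A00.
- split; first by apply/funext => y /=; exact: AA.
  apply/funext => y; apply: ip_nondeg => w.
  by rewrite /ip -adjointE// Asym.
- exists n; rewrite (_ : range A = [set y | A y = y])//.
  by apply/seteqP; split=> [_ [y _ <-]|y /= <-]; [exact: AA|exists y].
- rewrite isoE staE; split=> [v w /= Av Aw|].
    by rewrite -Aw -Asym Av inner0l.
  apply/seteqP; split=> // y _; exists (y - A y); first by rewrite /= opB AA subrr.
  by exists (A y); [exact: AA|rewrite subrK].
- exists n; last by rewrite isoE.
  (* For [n = 0] the projection is an empty sum, which contradicts [A x <> 0]. *)
  by rewrite lt0n; apply: contra_notN Ax => /eqP n0; subst n;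
    rewrite AP /oproj big_ord0.
Qed.
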